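(* Let $B$ be a generalized Bratteli diagram and let $\mathcal{R}$ be the tail equivalence relation on the path space $X_B$. If $\mathcal{R}$ is topologically transitive, then $B$ is connected.
   Context: A generalized Bratteli diagram is a graded graph $B=(V,E)$ with $V=\bigsqcup_{n\ge 0}V_n$ and $E=\bigsqcup_{n\ge 0}E_n$ such that: (i) each level $V_n$ and each edge set $E_n$ is countably infinite; (ii) there are source and range maps $s,r$ on $E$ with $s(E_n)=V_n$ and $r(E_n)=V_{n+1}$; (iii) $|r^{-1}(v)|<\infty$ for every $v\in V\setminus V_0$. Multiple edges are allowed. The path space $X_B$ is the set of all infinite paths $x=(x_n)_{n\ge0}$, $x_n\in E_n$, $s(x_{n+1})=r(x_n)$, with the topology generated by the cylinder sets $[(e_0,\dots,e_n)]=\{x\in X_B: x_0=e_0,\dots,x_n=e_n\}$. Two paths $x,y\in X_B$ are tail equivalent, $(x,y)\in\mathcal{R}$, if there is $n$ with $x_i=y_i$ for all $i\ge n$. The orbit of $x$ is $\mathcal{O}(x)=\{y\in X_B:(x,y)\in\mathcal{R}\}$. $\mathcal{R}$ is topologically transitive if there exists a point of $X_B$ whose orbit is dense in $X_B$. $B$ is connected if it is connected as an undirected graph (any two vertices of $V$ are joined by a path in the underlying undirected graph). *)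

(* Defs.v *)
From HB Require Import structures.
From mathcomp Require Import all_boot all_order.
From mathcomp Require Import boolp classical_sets functions cardinality topology.

Set Implicit Arguments.
Unset Strict Implicit.
Unset Printing Implicit Defensive.

Local Open Scope classical_set_scope.
Local Open Scope card_scope.

(* The disjoint unions V of the V_n and E of the E_n are encoded by families indexed
   by the level, so s : E_n -> V_n and r : E_n -> V_{n+1} hold by typing. *)
Record generalized_bratteli := GeneralizedBratteli {
  vertex : nat -> Type;
  edge : nat -> Type;
  src : forall n, edge n -> vertex n;
  rng : forall n, edge n -> vertex n.+1;
  vertex_countably_infinite : forall n, [set: vertex n] #= [set: nat];
  edge_countably_infinite : forall n, [set: edge n] #= [set: nat];
  src_image : forall n, range (@src n) = [set: vertex n];
  rng_image : forall n, range (@rng n) = [set: vertex n.+1];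
  rng_finite : forall n (v : vertex n.+1), finite_set (@rng n @^-1` [set v])
}.

Arguments src {_ n} _.
Arguments rng {_ n} _.

Record path_space (B : generalized_bratteli) := PathSpace {
  path_edge :> forall n, edge B n;
  path_edgeP : forall n, src (path_edge n.+1) = rng (path_edge n)
}.

(* Finite paths (e_0, ..., e_n).  For i : 'I_n, the indices [lift ord0 i] and
   [widen_ord (leqnSn n) i] of 'I_n.+1 are i + 1 and i. *)
Record finite_path (B : generalized_bratteli) (n : nat) := FinitePath {
  finite_path_edge :> forall i : 'I_n.+1, edge B i;
  finite_path_edgeP : forall i : 'I_n,
    src (finite_path_edge (lift ord0 i)) =
    rng (finite_path_edge (widen_ord (leqnSn n) i))
}.

Definition cylinder (B : generalized_bratteli) (n : nat) (e : finite_path B n) :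
    set (path_space B) :=
  [set x : path_space B | forall i : 'I_n.+1, x i = e i].

Definition cylinders (B : generalized_bratteli) : set (set (path_space B)) :=
  [set U | exists n (e : finite_path B n), U = cylinder e].

HB.instance Definition _ (B : generalized_bratteli) :=
  gen_eqMixin (path_space B).
HB.instance Definition _ (B : generalized_bratteli) :=
  gen_choiceMixin (path_space B).
HB.instance Definition _ (B : generalized_bratteli) :=
  isSubBaseTopological.Build (path_space B) (@cylinders B) id.

Definition tail_equivalence (B : generalized_bratteli) (x y : path_space B) :
    Prop :=
  exists n, forall i, n <= i -> x i = y i.

Definition equivalence_orbit (B : generalized_bratteli)
    (R : path_space B -> path_space B -> Prop) (x : path_space B) :
    set (path_space B) :=
  [set y | R x y].

Definition topologically_transitive (B : generalized_bratteli)
    (R : path_space B -> path_space B -> Prop) : Prop :=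
  exists x, dense (equivalence_orbit R x).

Definition all_vertices (B : generalized_bratteli) : Type := {n & vertex B n}.

Definition all_edges (B : generalized_bratteli) : Type := {n & edge B n}.

Definition source (B : generalized_bratteli) (e : all_edges B) :
    all_vertices B :=
  Tagged (vertex B) (src (tagged e)).

Definition target (B : generalized_bratteli) (e : all_edges B) :
    all_vertices B :=
  Tagged (vertex B) (rng (tagged e)).

Definition adjacent (B : generalized_bratteli) (u v : all_vertices B) : Prop :=
  exists e : all_edges B,
    (source e = u /\ target e = v) \/ (source e = v /\ target e = u).

Definition connected_diagram (B : generalized_bratteli) : Prop :=
  forall u v : all_vertices B, exists p : seq (all_vertices B),
    path (fun a b => `[< adjacent a b >]) u p /\ last u p = v.

(* Main.v *)
(** Every edge [e] at level [n] lies on an infinite path: extend [e] backwards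
    through [r] and forwards through [s], both surjective.  The cylinder of
    the first [n + 1] edges of that path is open and nonempty, so the dense orbit
    of [x] contains a path that uses [e] and eventually agrees with [x].  Hence
    every vertex is joined to the source of the first edge of [x]. *)
From mathcomp Require Import all_boot boolp classical_sets topology.
Require Import Defs.

Set Implicit Arguments.
Unset Strict Implicit.
Unset Printing Implicit Defensive.

Local Open Scope classical_set_scope.

Definition joined (B : generalized_bratteli) (u v : all_vertices B) : Prop :=
  exists p : seq (all_vertices B),
    path (fun a b => `[< adjacent a b >]) u p /\ last u p = v.

Lemma joined_trans (B : generalized_bratteli) (v u w : all_vertices B) :
  joined u v -> joined v w -> joined u w.
Proof.
move=> [p [pp <-]] [q [pq <-]]; exists (p ++ q).
by rewrite cat_path last_cat pp pq.
Qed.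

Lemma adjacent_sym (B : generalized_bratteli) (u v : all_vertices B) :
  adjacent u v -> adjacent v u.
Proof. by case=> e [] ?; exists e; [right|left]. Qed.

Lemma joined_sym (B : generalized_bratteli) (u v : all_vertices B) :
  joined u v -> joined v u.
Proof.
(* [belast u p] keeps [u] and drops the endpoint, so its reversal is the walk back, ending at
   [u]. *)
move=> [p [pp <-]]; exists (rev (belast u p)); split.
  rewrite rev_path; apply: sub_path pp => a b /asboolP ab.
  exact/asboolP/adjacent_sym.
by case: p {pp} => //= a p; rewrite rev_cons last_rcons.
Qed.

Lemma joined_path (B : generalized_bratteli) (x : path_space B) (n : nat) :
  joined (source (Tagged (edge B) (x 0))) (source (Tagged (edge B) (x n))).
Proof.
elim: n => [|n IHn]; first by exists [::].
apply: joined_trans IHn _.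
exists [:: source (Tagged (edge B) (x n.+1))]; split=> //=.
rewrite andbT; apply/asboolP; exists (Tagged (edge B) (x n)); left.
by split=> //; rewrite /target /source /= path_edgeP.
Qed.

Lemma src_surj (B : generalized_bratteli) (n : nat) (v : vertex B n) :
  exists e : edge B n, src e = v.
Proof.
by have: [set: vertex B n] v by []; rewrite -src_image => -[e _ <-]; exists e.
Qed.

Lemma rng_surj (B : generalized_bratteli) (n : nat) (v : vertex B n.+1) :
  exists e : edge B n, rng e = v.
Proof.
by have: [set: vertex B n.+1] v by []; rewrite -rng_image => -[e _ <-]; exists e.
Qed.

(** A total family [f] stands in for a finite path: its values beyond level [n] are arbitrary and
    get discarded. *)
Lemma path_extension (B : generalized_bratteli) (n : nat)
    (f : forall k, edge B k) :
  (forall k, k < n -> src (f k.+1) = rng (f k)) ->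
  exists y : path_space B, forall k, k <= n -> y k = f k.
Proof.
move=> fP.
pose next k (v : vertex B k) := projT1 (cid (src_surj v)).
have nextP k (v : vertex B k) : src (next k v) = v.
  exact: projT2 (cid (src_surj v)).
(* Copy [f] up to level [n] included, then keep choosing an edge that leaves the current range. *)
pose z := nat_rect (edge B) (f 0)
  (fun k e => if k < n then f k.+1 else next k.+1 (rng e)).
have zf k : k <= n -> z k = f k by case: k => //= k ->.
have zP k : src (z k.+1) = rng (z k).
  rewrite /=; case: ifP => [kn|_]; last exact: nextP.
  by rewrite fP // zf // ltnW.
by exists (PathSpace zP).
Qed.

Lemma path_through_edge (B : generalized_bratteli) (n : nat) (e : edge B n) :
  exists y : path_space B, y n = e.
Proof.
elim: n e => [|n IHn] e.
  (* At level 0 the compatibility condition is vacuous; [next] only serves to fill the higher levels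
     with some edge. *)
  pose next k (d : edge B k) := projT1 (cid (src_surj (rng d))).
  have [] // := @path_extension B 0 (nat_rect (edge B) e next).
  by move=> y /(_ 0 isT); exists y.
have [d de] := rng_surj (src e); have [y yd] := IHn d.
(* The path [y] through the predecessor [d] may leave [d] by an edge other than [e]: overwrite level
   [n.+1] by [e] and rebuild the tail after it. *)
pose f := dfwith (path_edge y) e.
have fy k : k <= n -> f k = y k.
  by move=> kn; rewrite /f dfwith_out // gtn_eqF // ltnS.
have fe : f n.+1 = e by rewrite /f dfwith_in.
have [|z zf] := @path_extension B n.+1 f; last by exists z; rewrite zf.
move=> k; rewrite ltnS leq_eqVlt => /predU1P[->|kn].
  by rewrite fe fy // yd de.
by rewrite !fy ?path_edgeP // ltnW.
Qed.

Definition path_prefix (B : generalized_bratteli) (y : path_space B) (n : nat) :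
    finite_path B n :=
  @FinitePath B n (fun i => y i) (fun i => path_edgeP y i).

Lemma open_cylinder (B : generalized_bratteli) (n : nat)
  (e : finite_path B n) : open (cylinder e).
Proof.
(* Open sets are unions of finite intersections of cylinders; one cylinder is the trivial case. *)
exists [set cylinder e]; last by rewrite bigcup_set1.
by move=> _ ->; apply: finI_from1; exists n, e.
Qed.

Lemma dense_orbit_edge (B : generalized_bratteli) (x : path_space B) (n : nat)
    (e : edge B n) :
  dense (equivalence_orbit (@tail_equivalence B) x) ->
  exists2 z : path_space B, z n = e & tail_equivalence x z.
Proof.
move=> xdense; have [y <-] := path_through_edge e.
have [|z [zy xz]] := xdense _ _ (open_cylinder (path_prefix y n)).
  by exists y.
by exists z => //; have := zy ord_max.
Qed.

Theorem proposition4p18 (B : generalized_bratteli) :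
  topologically_transitive (@tail_equivalence B) -> connected_diagram B.
Proof.
move=> [x xdense].
suff joined_x v : joined (source (Tagged (edge B) (x 0))) v.
  by move=> u v; apply: joined_trans (joined_sym (joined_x u)) (joined_x v).
case: v => n v; have [e <-] := src_surj v.
have [z <- [N xz]] := dense_orbit_edge e xdense.
(* Follow [x] up to level [N], where it shares an edge with [z], then go back along [z] to level 0
   and forward along [z] to level [n]. *)
apply: joined_trans (joined_path x N) _; rewrite xz //.
exact: joined_trans (joined_sym (joined_path z N)) (joined_path z n).
Qed.
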